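(* Let $Z_{\tau\in[0,T]}$ be the Markovian Bernstein process associated with the forward-backward system $$\partial_t u=\tfrac12\Delta_{\mathsf x}u-V(\mathsf x)u\ \text{ on }\mathbb R^d\times(0,T],\quad u(\cdot,0)=\varphi=\mathcal N\varphi_0,$$ $$-\partial_t v=\tfrac12\Delta_{\mathsf x}v-V(\mathsf x)v\ \text{ on }\mathbb R^d\times[0,T),\quad v(\cdot,T)=\psi=\mathcal N\psi_T,$$ (in the sense recalled in the context), where $$\varphi_0(\mathsf x)=\prod_{j=1}^d\left(\left(1-\frac{|x_j-a_{0,j}|}{\sigma_0}\right)\vee 0\right),\qquad \psi_T(\mathsf x)=\prod_{j=1}^d\left(\left(1-\frac{|x_j-a_{T,j}|}{\sigma_T}\right)\vee 0\right)$$ with $\sigma_0,\sigma_T>0$ and $\mathsf a_0,\mathsf a_T\in\mathbb R^d$ arbitrary. Let $$\mathsf C_{\mathsf a_0,\sigma_0}=\{\mathsf x\in\mathbb R^d: |x_j-a_{0,j}|<\sigma_0,\ j=1,\dots,d\},\qquad \mathsf C_{\mathsf a_T,\sigma_T}=\{\mathsf x\in\mathbb R^d: |x_j-a_{T,j}|<\sigma_T,\ j=1,\dots,d\}.$$ Then $$\mathbb P_\mu(Z_0\in\mathsf C_{\mathsf a_0,\sigma_0})=1\qquad\text{and}\qquad \mathbb P_\mu(Z_T\in\mathsf C_{\mathsf a_T,\sigma_T})=1.$$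
   Context: Let $d\in\mathbb N^+$ and $T\in(0,+\infty)$ be arbitrary. The function $V:\mathbb R^d\to\mathbb R$ is continuous, bounded from below and satisfies $V(\mathsf x)\to+\infty$ as $|\mathsf x|\to+\infty$. Consequently the usual self-adjoint realization of $-\frac12\Delta_{\mathsf x}+V$ in $L^2_{\mathbb C}(\mathbb R^d)$ has purely discrete spectrum $(E_{\mathsf n})_{\mathsf n\in\mathbb N^d}$; it is assumed that $\sum_{\mathsf n\in\mathbb N^d}\exp[-tE_{\mathsf n}]<+\infty$ for every $t\in(0,T]$. Let $g(\mathsf x,t,\mathsf y)$ be the associated Green's function (heat kernel), which satisfies $g(\mathsf x,t,\mathsf y)=g(\mathsf y,t,\mathsf x)>0$ for all $\mathsf x,\mathsf y\in\mathbb R^d$, $t\in(0,T]$. The constant $\mathcal N>0$ is defined by the normalization condition $$\mathcal N^2\int_{\mathbb R^d\times\mathbb R^d}\varphi_0(\mathsf x)g(\mathsf x,T,\mathsf y)\psi_T(\mathsf y)\,d\mathsf x\,d\mathsf y=1,$$ and the probability measure $\mu$ on $\mathbb R^d\times\mathbb R^d$ has density $\varphi(\mathsf x)g(\mathsf x,T,\mathsf y)\psi(\mathsf y)$. The solutions of the two Cauchy problems are $u(\mathsf x,t)=\int_{\mathbb R^d}g(\mathsf x,t,\mathsf y)\varphi(\mathsf y)\,d\mathsf y$ (with $u(\cdot,0)=\varphi$) and $v(\mathsf x,t)=\int_{\mathbb R^d}g(\mathsf x,T-t,\mathsf y)\psi(\mathsf y)\,d\mathsf y$ (with $v(\cdot,T)=\psi$).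 An $\mathbb R^d$-valued process $Z_{\tau\in[0,T]}$ is a Bernstein process if $\mathbb E(f(Z_r)\mid\mathcal F_s^+\vee\mathcal F_t^-)=\mathbb E(f(Z_r)\mid Z_s,Z_t)$ for every bounded Borel $f:\mathbb R^d\to\mathbb R$ and all $r\in(s,t)\subset[0,T]$, where $\mathcal F_s^+=\sigma(Z_\tau:\tau\le s)$ and $\mathcal F_t^-=\sigma(Z_\tau:\tau\ge t)$. The Bernstein process associated with the forward-backward system is the Markovian Bernstein process on a probability space $(\Omega,\mathcal F,\mathbb P_\mu)$ such that: (i) $(Z_0,Z_T)$ has law $\mu$; (ii) for $n\ge2$, $0<t_1<\dots<t_n<T$ and Borel sets $F_1,\dots,F_n$, $$\mathbb P_\mu(Z_{t_1}\in F_1,\dots,Z_{t_n}\in F_n)=\int_{F_1}d\mathsf x_1\cdots\int_{F_n}d\mathsf x_n\prod_{k=2}^n g(\mathsf x_k,t_k-t_{k-1},\mathsf x_{k-1})\,u(\mathsf x_1,t_1)v(\mathsf x_n,t_n);$$ (iii) $\mathbb P_\mu(Z_t\in F)=\int_F u(\mathsf x,t)v(\mathsf x,t)\,d\mathsf x$ for every Borel set $F\subset\mathbb R^d$ and every $t\in[0,T]$. *)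

(* Defs.v *)
From HB Require Import structures.
From mathcomp Require Import all_boot all_order all_algebra.
From mathcomp Require Import complex.
From mathcomp Require Import all_classical all_reals all_analysis.
From mathcomp Require Import measurable_realfun.
Import Order.TTheory GRing.Theory Num.Theory.
Import numFieldNormedType.Exports.

Set Implicit Arguments.
Unset Strict Implicit.
Unset Printing Implicit Defensive.

Local Open Scope classical_set_scope.
Local Open Scope ring_scope.

Section borel_rV.
Variables (R : realType) (n : nat).
Let G : set (set 'rV[R]_n) := <<s @open 'rV[R]_n >>.
Let G0 : G set0. Proof. exact: sigma_algebra0. Qed.
Let GC A : G A -> G (~` A). Proof. exact: sigma_algebraC. Qed.
Let GU (F : _^nat) : (forall i, G (F i)) -> G (\bigcup_i F i).
Proof. exact: sigma_algebra_bigcup. Qed.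

HB.instance Definition _ :=
  @isMeasurable.Build (sigma_display (@open 'rV[R]_n)) 'rV[R]_n G G0 GC GU.
End borel_rV.

Section measurable_rV.
Variable R : realType.

Lemma open_measurable_rV n (U : set 'rV[R]_n) : open U -> measurable U.
Proof. exact: sub_sigma_algebra. Qed.

Lemma measurable_coord_rV n (i : 'I_n) :
  measurable_fun setT (fun x : 'rV[R]_n => x 0 i : measurableTypeR R).
Proof.
apply: (measurability _ (RGenOInfty.measurableE R)) => _ [_ [a ->] <-].
rewrite setTI; apply: open_measurable_rV.
apply: open_comp; first by move=> x _; exact: coord_continuous.
exact: rray_open.
Qed.

Lemma measurable_fun_rVP d (T : measurableType d) n (f : T -> 'rV[R]_n) :
  (forall i, measurable_fun setT (fun t => f t 0 i)) -> measurable_fun setT f.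
Proof.
move=> mf; apply: (@measurability _ _ _ _ _ f (@open 'rV[R]_n)) => //.
move=> _ [U oU <-]; rewrite setTI.
pose qv (q : 'rV[rat]_n) : 'rV[R]_n := map_mx ratr q.
pose B (p : 'rV[rat]_n * nat) : set 'rV[R]_n :=
  [set x | forall i, `|ratr (p.1 0 i) - x 0 i| < p.2.+1%:R^-1].
have -> : f @^-1` U = \bigcup_p (if pselect (B p `<=` U) then f @^-1` B p else set0).
  apply/seteqP; split=> [t Ut|t [p _]]; last first.
    by case: pselect => // BU /BU.
  have /nbhs_ballP[e /= e0 eU] : nbhs (f t) U by exact: open_nbhs_nbhs.
  have [k ke] : exists k, k.+1%:R^-1 < e / 2 :> R.
    have /cvgrPdist_lt/(_ (e / 2)) := @cvg_harmonic R.
    rewrite divr_gt0// => /(_ isT)[k _ /(_ k (leqnn k))/=].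
    by rewrite sub0r normrN ger0_norm// => ?; exists k.
  have qP i : exists q : rat, `|ratr q - f t 0 i| < k.+1%:R^-1.
    have [q] := @rat_in_itvoo R (f t 0 i) (f t 0 i + k.+1%:R^-1)
      (ltac:(by rewrite ltrDl)).
    rewrite in_itv/= => /andP[q1 q2]; exists q.
    by rewrite gtr0_norm ?subr_gt0// ltrBlDl.
  have [q qE] := choice qP.
  exists (\row_i q i, k) => //=.
  case: pselect => /= [_ i|[]]; first by rewrite mxE.
  move=> x Bx; apply: eU; rewrite mx_norm_ball /ball_ /=.
  have e2 : 0 < e by [].
  rewrite /Num.norm/= mx_normrE; apply/bigmax_ltP; split => // -[a b] _ /=.
  rewrite !mxE !(ord1 a).
  have := Bx b; rewrite /= mxE => xb; have fb := qE b.
  rewrite -(subrK (ratr (q b)) (f t 0 b)) -addrA (le_lt_trans (ler_normD _ _))//.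
  rewrite (splitr e) ltrD// ?(lt_trans xb)//.
  by rewrite distrC (lt_trans fb).
apply: countable_bigcupT_measurable => [|p]; first exact: countableP.
case: pselect => //= _.
have -> : f @^-1` B p = \bigcap_(i in [set: 'I_n])
    ((fun t => f t 0 i) @^-1` ball (ratr (p.1 0 i) : R) p.2.+1%:R^-1).
  by apply/seteqP; split => t Bt i; [move=> _; exact: Bt|exact: Bt].
apply: fin_bigcap_measurable => // i _; rewrite -[X in measurable X]setTI.
exact: mf (measurable_ball _ _).
Qed.

End measurable_rV.

Section lebesgue_rV.
Variable R : realType.

Definition rV_cons n (p : measurableTypeR R * 'rV[R]_n) : 'rV[R]_n.+1 :=
  \row_(i < n.+1) oapp (fun j => p.2 0 j) p.1 (unlift ord0 i).

Definition rV_uncons n (x : 'rV[R]_n.+1) : measurableTypeR R * 'rV[R]_n :=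
  (x 0 ord0, \row_(j < n) x 0 (lift ord0 j)).

Lemma rV_consK n : cancel (@rV_cons n) (@rV_uncons n).
Proof.
move=> [a y]; rewrite /rV_uncons mxE unlift_none /=; congr pair.
by apply/rowP => j; rewrite !mxE liftK.
Qed.

Lemma rV_unconsK n : cancel (@rV_uncons n) (@rV_cons n).
Proof.
move=> x; apply/rowP => i; rewrite mxE.
by case: unliftP => [j ->|->] /=; rewrite ?mxE.
Qed.

Lemma measurable_rV_cons n : measurable_fun setT (@rV_cons n).
Proof.
apply: measurable_fun_rVP => i.
case: (unliftP ord0 i) => [j ->|->].
  rewrite [X in measurable_fun _ X](_ : _ = (fun x : 'rV[R]_n => x 0 j) \o snd).
    by apply: measurableT_comp => //; exact: measurable_coord_rV.
  by apply/funext => p; rewrite mxE liftK.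
rewrite [X in measurable_fun _ X](_ : _ = fst)//.
by apply/funext => p; rewrite mxE unlift_none.
Qed.

Lemma measurable_rV_uncons n : measurable_fun setT (@rV_uncons n).
Proof.
apply/measurable_fun_pairP; split; first exact: measurable_coord_rV.
apply: measurable_fun_rVP => i.
rewrite [X in measurable_fun _ X](_ : _ = (fun x : 'rV[R]_n.+1 => x 0 (lift ord0 i))).
  exact: measurable_coord_rV.
by apply/funext => x; rewrite mxE.
Qed.

Section step.
Variables (n : nat) (mu : {sigma_finite_measure set 'rV[R]_n -> \bar R}).

Definition lebesgue_rVS (A : set 'rV[R]_n.+1) : \bar R :=
  (@lebesgue_measure R \x mu)%E (@rV_cons n @^-1` A).

Let mpre (A : set 'rV[R]_n.+1) : measurable A -> measurable (@rV_cons n @^-1` A).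
Proof. by move=> mA; rewrite -[X in measurable X]setTI; exact: measurable_rV_cons. Qed.

Let step0 : lebesgue_rVS set0 = 0%E.
Proof. by rewrite /lebesgue_rVS preimage_set0 measure0. Qed.

Let step_ge0 A : (0 <= lebesgue_rVS A)%E.
Proof. exact: measure_ge0. Qed.

Let step_sigma_additive : semi_sigma_additive lebesgue_rVS.
Proof.
move=> F mF tF mUF; rewrite /lebesgue_rVS preimage_bigcup.
apply: measure_semi_sigma_additive.
- by move=> k; exact: mpre.
- apply/trivIsetP => /= i j _ _ ij; rewrite -preimage_setI.
  by move/trivIsetP : tF => /(_ _ _ _ _ ij) ->//; rewrite preimage_set0.
- by rewrite -preimage_bigcup; exact: mpre.
Qed.

HB.instance Definition _ := isMeasure.Build _ _ _ lebesgue_rVS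
  step0 step_ge0 step_sigma_additive.

Let step_sigma_finite : sigma_finite setT lebesgue_rVS.
Proof.
have /sigma_finiteP[F [FT ndF Foo]] := sigma_finiteT (@lebesgue_measure R).
have /sigma_finiteP[G [GT ndG Goo]] := sigma_finiteT mu.
exists (fun k => @rV_uncons n @^-1` (F k `*` G k)).
  rewrite -preimage_bigcup; apply/esym; rewrite -subTset => x _ /=.
  have [i _ Fi] : (\bigcup_k F k) (rV_uncons x).1 by rewrite -FT.
  have [j _ Gj] : (\bigcup_k G k) (rV_uncons x).2 by rewrite -GT.
  exists (maxn i j) => //; split.
  - by move: Fi; exact/subsetPset/ndF/leq_maxl.
  - by move: Gj; exact/subsetPset/ndG/leq_maxr.
move=> k; have [mF Fk] := Foo k; have [mG Gk] := Goo k; split.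
  rewrite -[X in measurable X]setTI; apply: measurable_rV_uncons => //.
  exact: measurableX.
rewrite /lebesgue_rVS -comp_preimage (_ : _ \o _ = id); last first.
  by apply/funext => p /=; rewrite rV_consK.
by rewrite preimage_id product_measure1E// lte_mul_pinfty// ge0_fin_numE.
Qed.

HB.instance Definition _ := Measure_isSigmaFinite.Build _ _ _ lebesgue_rVS
  step_sigma_finite.

End step.

Fixpoint lebesgue_rV n : {sigma_finite_measure set 'rV[R]_n -> \bar R} :=
  match n with
  | 0 => \d_(0 : 'rV[R]_0)
  | n'.+1 => lebesgue_rVS (lebesgue_rV n')
  end.

End lebesgue_rV.

(* L^2_C(R^d) as a space of Borel measurable representatives. *)
Section L2.
Variables (R : realType) (d : nat).
Local Notation leb := (@lebesgue_rV R d).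

Definition cintegral (f : 'rV[R]_d -> R[i]) : R[i] :=
  Complex (\int[leb]_x @complex.Re R (f x)) (\int[leb]_x @complex.Im R (f x)).

Definition square_integrable (f : 'rV[R]_d -> R[i]) : Prop :=
  [/\ measurable_fun setT (@complex.Re R \o f),
      measurable_fun setT (@complex.Im R \o f) &
      (\int[leb]_x ((@complex.Re R (f x)) ^+ 2 + (@complex.Im R (f x)) ^+ 2)%:E
         < +oo)%E].

Definition inner (f h : 'rV[R]_d -> R[i]) : R[i] :=
  cintegral (fun x => f x * conjc (h x)).

End L2.

Section schroedinger.
Variables (R : realType) (d : nat).
Local Notation leb := (@lebesgue_rV R d).

Definition partial (i : 'I_d) (f : 'rV[R]_d -> R) : 'rV[R]_d -> R :=
  fun x => 'D_(delta_mx 0 i) f x.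

Definition laplacian (f : 'rV[R]_d -> R) : 'rV[R]_d -> R :=
  fun x => \sum_(i < d) partial i (partial i f) x.

Definition smooth (f : 'rV[R]_d -> R) : Prop :=
  forall s : seq 'I_d, let h := foldr partial f s in
    continuous h /\ forall i x, derivable h x (delta_mx 0 i).

Definition test_function (f : 'rV[R]_d -> R) : Prop :=
  smooth f /\ compact (closure [set x | f x != 0]).

(* [schroedinger V f h] : f lies in the domain of the self-adjoint realization
   H of -1/2 Delta + V, and H f = h.  For V continuous and bounded from below,
   -1/2 Delta + V is essentially self-adjoint on the test functions, so that H
   is the adjoint of this minimal operator: H f is -1/2 Delta f + V f in the
   sense of distributions, with domain all f in L^2 for which it is in L^2. *)
Definition schroedinger (V : 'rV[R]_d -> R) (f h : 'rV[R]_d -> R[i]) : Prop :=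
  [/\ square_integrable f, square_integrable h &
      forall eta, test_function eta ->
        cintegral (fun x => f x * (- 2^-1 * laplacian eta x + V x * eta x)%:C%C)
        = cintegral (fun x => h x * (eta x)%:C%C)].

(* (E n) is the spectrum of H, with multiplicities: e is an orthonormal basis of
   L^2 with H (e n) = E n * e n. *)
Definition eigenbasis (V : 'rV[R]_d -> R) (E : {ffun 'I_d -> nat} -> R)
    (e : {ffun 'I_d -> nat} -> 'rV[R]_d -> R[i]) : Prop :=
  [/\ forall n, schroedinger V (e n) (fun x => (E n)%:C%C * e n x),
      forall m n, inner (e m) (e n) = (m == n)%:R &
      forall h, square_integrable h -> (forall n, inner h (e n) = 0) ->
        {ae leb, forall x, h x = 0}].

(* w = exp (- t H) h, through the expansion of H in the basis e. *)
Definition semigroup (E : {ffun 'I_d -> nat} -> R)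
    (e : {ffun 'I_d -> nat} -> 'rV[R]_d -> R[i]) (t : R)
    (h w : 'rV[R]_d -> R[i]) : Prop :=
  square_integrable w /\
  forall n, inner w (e n) = (expR (- t * E n))%:C%C * inner h (e n).

(* g is the continuous integral kernel of exp (- t H) for t in (0, T]. *)
Definition green_function (E : {ffun 'I_d -> nat} -> R)
    (e : {ffun 'I_d -> nat} -> 'rV[R]_d -> R[i]) (T : R)
    (g : 'rV[R]_d -> R -> 'rV[R]_d -> R) : Prop :=
  [/\ {within [set p : 'rV[R]_d * R * 'rV[R]_d | 0 < p.1.2 <= T],
        continuous (fun p => g p.1.1 p.1.2 p.2)},
      forall x t, 0 < t <= T -> square_integrable (fun y => (g x t y)%:C%C) &
      forall t h, 0 < t <= T -> square_integrable h ->
        semigroup E e t h (fun x => cintegral (fun y => (g x t y)%:C%C * h y))].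

End schroedinger.

Section conditional.
Context {disp : measure_display} {Om : measurableType disp} {R : realType}.
Variable P : probability Om R.
Implicit Types (F G : set (set Om)) (X Y : Om -> R).

(* Y is a version of E (X | G). *)
Definition is_cond_exp G X Y : Prop :=
  [/\ forall B : set R, measurable B -> G (Y @^-1` B),
      P.-integrable setT (EFin \o Y) &
      forall A, G A -> (\int[P]_(w in A) (Y w)%:E = \int[P]_(w in A) (X w)%:E)%E].

(* E (X | F) = E (X | G) almost surely, for G included in F: some version of
   E (X | G) is a version of E (X | F). *)
Definition same_cond_exp F G X : Prop :=
  exists Y, is_cond_exp F X Y /\ is_cond_exp G X Y.

Definition sigma_process d (Z : R -> Om -> 'rV[R]_d) (J : set R) :
    set (set Om) :=
  <<s [set A | exists2 t, J t &
         exists2 B : set 'rV[R]_d, measurable B & A = Z t @^-1` B] >>.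

Definition bounded_borel d (f : 'rV[R]_d -> R) : Prop :=
  measurable_fun setT f /\ exists M, forall x, `|f x| <= M.

Definition markov_process d (T : R) (Z : R -> Om -> 'rV[R]_d) : Prop :=
  forall f s t, bounded_borel f -> 0 <= s -> s <= t -> t <= T ->
    same_cond_exp (sigma_process Z `[0, s]) (sigma_process Z [set s]) (f \o Z t).

Definition bernstein_process d (T : R) (Z : R -> Om -> 'rV[R]_d) : Prop :=
  forall f s r t, bounded_borel f -> 0 <= s -> s < r -> r < t -> t <= T ->
    same_cond_exp
      <<s sigma_process Z `[0, s] `|` sigma_process Z `[t, T] >>
      (sigma_process Z [set s; t]) (f \o Z r).

End conditional.

Section forward_backward.
Variables (R : realType) (d : nat).
Local Notation leb := (@lebesgue_rV R d).
Implicit Types (T : R) (g : 'rV[R]_d -> R -> 'rV[R]_d -> R).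
Implicit Types (phi psi : 'rV[R]_d -> R).

(* The measure with density phi x * g x T y * psi y on R^d x R^d. *)
Definition boundary_measure T g phi psi (A : set ('rV[R]_d * 'rV[R]_d)) :
    \bar R :=
  (\int[leb \x leb]_(p in A) (phi p.1 * g p.1 T p.2 * psi p.2)%:E)%E.

(* Solution of d_t u = 1/2 Delta u - V u with u(., 0) = phi, where g is the Green
   function of this equation, and of - d_t v = 1/2 Delta v - V v with
   v(., T) = psi. *)
Definition forward_solution g phi (x : 'rV[R]_d) (t : R) : R :=
  if t == 0 then phi x else \int[leb]_y (g x t y * phi y).

Definition backward_solution T g psi (x : 'rV[R]_d) (t : R) : R :=
  if t == T then psi x else \int[leb]_y (g x (T - t) y * psi y).

(* \int_{F (k+1)} dx_{k+1} ... \int_{F (k+m)} dx_{k+m}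
     acc * \prod_{k < j <= k+m} g x_j (t j - t (j-1)) x_{j-1} * v x_{k+m} (t (k+m))
   where x_k = x. *)
Fixpoint chain_integral g (v : 'rV[R]_d -> R -> R) (t : nat -> R)
    (F : nat -> set 'rV[R]_d) (k m : nat) (acc : R) (x : 'rV[R]_d) : \bar R :=
  match m with
  | 0 => (acc * v x (t k))%:E
  | m'.+1 => (\int[leb]_(y in F k.+1)
      chain_integral g v t F k.+1 m' (acc * g y (t k.+1 - t k)%R x)%R y)%E
  end.

(* The times and Borel sets t_1, ..., t_n and F_1, ..., F_n are t 0, ..., t n.-1
   and F 0, ..., F n.-1. *)
Record associated_bernstein (T : R) g phi psi
    {disp : measure_display} {Om : measurableType disp}
    (P : probability Om R) (Z : R -> Om -> 'rV[R]_d) : Prop := {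
  assoc_measurable : forall t, 0 <= t <= T -> measurable_fun setT (Z t) ;
  assoc_markov : markov_process P T Z ;
  assoc_bernstein : bernstein_process P T Z ;
  assoc_joint_law : forall A : set ('rV[R]_d * 'rV[R]_d), measurable A ->
    P [set w | A (Z 0 w, Z T w)] = boundary_measure T g phi psi A ;
  assoc_fdd : forall (n : nat) (t : nat -> R) (F : nat -> set 'rV[R]_d),
    (2 <= n)%N -> 0 < t 0%N -> (forall k, (k.+1 < n)%N -> t k < t k.+1) ->
    t n.-1 < T -> (forall k, (k < n)%N -> measurable (F k)) ->
    P [set w | forall k, (k < n)%N -> F k (Z (t k) w)] =
    (\int[leb]_(x in F 0%N)
       chain_integral g (backward_solution T g psi) t F 0 n.-1
         (forward_solution g phi x (t 0%N)) x)%E ;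
  assoc_marginal : forall (t : R) (F : set 'rV[R]_d),
    0 <= t <= T -> measurable F ->
    P (Z t @^-1` F) =
    (\int[leb]_(x in F)
       (forward_solution g phi x t * backward_solution T g psi x t)%:E)%E }.

Definition tent (a : 'rV[R]_d) (s : R) (x : 'rV[R]_d) : R :=
  \prod_(j < d) Num.max (1 - `|x 0 j - a 0 j| / s) 0.

Definition cube (a : 'rV[R]_d) (s : R) : set 'rV[R]_d :=
  [set x | forall j, `|x 0 j - a 0 j| < s].

End forward_backward.

(* Main.v *)
Require Import Defs.
From HB Require Import structures.
From mathcomp Require Import all_boot all_order all_algebra.
From mathcomp Require Import complex.
From mathcomp Require Import all_classical all_reals all_analysis.
From mathcomp Require Import measurable_realfun.
Import Order.TTheory GRing.Theory Num.Theory.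
Import numFieldNormedType.Exports.
Local Open Scope classical_set_scope.
Local Open Scope ring_scope.

(** The one-time marginal law, which holds at the endpoints too, gives [Z t] the density
    $u(\cdot,t)v(\cdot,t)$. At time 0 the factor $u$ is the initial datum, a multiple of
    [tent a0 s0]; at time [T] the factor $v$ is the final datum, a multiple of [tent aT sT]. Each
    tent vanishes off its open cube ([tent_outside_cube]), so the complement of the cube has
    probability zero ([probability1_density_null]). *)

Lemma tent_outside_cube (R : realType) (d : nat) (a : 'rV[R]_d) (s : R) x :
  0 < s -> ~ cube a s x -> tent a s x = 0.
Proof.
move=> s_gt0 /existsNP[j /negP]; rewrite -leNgt => le_sx.
(* A single coordinate [j] at distance at least [s] from the centre truncates its factor to 0, which
   kills the whole product. *)
rewrite /tent (bigD1 j)//= (_ : Num.max _ _ = 0) ?mul0r//.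
by apply/max_idPr; rewrite subr_le0 ler_pdivlMr// mul1r.
Qed.

Lemma measurable_cube {R : realType} {d : nat} (a : 'rV[R]_d) (s : R) :
  measurable (cube a s).
Proof.
have -> : cube a s = \bigcap_(j in [set: 'I_d])
    ((fun x : 'rV[R]_d => x 0 j : measurableTypeR R) @^-1` ball (a 0 j : R) s).
  apply/seteqP; split=> x xC j; first by move=> _; rewrite /= /ball/= distrC.
  by have := xC j I; rewrite /= /ball/= distrC.
apply: fin_bigcap_measurable => // j _; rewrite -[X in measurable X]setTI.
exact: measurable_coord_rV (measurable_ball _ _).
Qed.

(** The density is only integrated over the complement of [C], where it is identically zero; the
    total mass 1 comes from [P] being a probability, so no integral over [C] has to be computed. *)
Lemma probability1_density_null {R : realType} {d1 d2 : measure_display}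
    {Om : measurableType d1} {X : measurableType d2}
    {mu : {measure set X -> \bar R}} {P : probability Om R}
    {Y : Om -> X} {rho : X -> R} {C : set X} :
  measurable_fun setT Y -> measurable C -> (forall x, ~ C x -> rho x = 0) ->
  P (Y @^-1` (~` C)) = (\int[mu]_(x in ~` C) (rho x)%:E)%E ->
  P (Y @^-1` C) = 1%E.
Proof.
move=> mY mC rho0 PC.
have mYC : measurable (Y @^-1` C).
  by rewrite -[X in measurable X]setTI; exact: mY.
rewrite -[Y @^-1` C]setCK probability_setC; last exact: measurableC.
rewrite preimage_setC PC integral0_eq ?sube0// => x /= Cx.
by rewrite rho0.
Qed.

Theorem proposition1 (R : realType) (d : nat) (T : R)
    (V : 'rV[R]_d -> R)
    (E : {ffun 'I_d -> nat} -> R) (e : {ffun 'I_d -> nat} -> 'rV[R]_d -> R[i])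
    (g : 'rV[R]_d -> R -> 'rV[R]_d -> R)
    (a0 aT : 'rV[R]_d) (s0 sT N : R)
    (disp : measure_display) (Om : measurableType disp) (P : probability Om R)
    (Z : R -> Om -> 'rV[R]_d)
    (d_gt0 : (0 < d)%N) (T_gt0 : 0 < T)
    (V_continuous : continuous V)
    (V_bounded_below : exists m : R, forall x, m <= V x)
    (V_coercive : forall M : R, exists r : R, forall x, r <= `|x| -> M <= V x)
    (E_spectrum : eigenbasis V E e)
    (E_summable : forall t : R, 0 < t <= T ->
       (\esum_(n in [set: {ffun 'I_d -> nat}]) (expR (- t * E n))%:E < +oo)%E)
    (g_green : green_function E e T g)
    (g_sym_gt0 : forall x t y, 0 < t <= T -> g x t y = g y t x /\ 0 < g x t y)
    (s0_gt0 : 0 < s0) (sT_gt0 : 0 < sT) (N_gt0 : 0 < N)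
    (N_normalization :
       ((N ^+ 2)%:E *
        \int[@lebesgue_rV R d \x @lebesgue_rV R d]_p
          (tent a0 s0 p.1 * g p.1 T p.2 * tent aT sT p.2)%:E = 1)%E)
    (Z_bernstein : associated_bernstein T g
       (fun x => N * tent a0 s0 x) (fun x => N * tent aT sT x) P Z) :
  P [set w | cube a0 s0 (Z 0 w)] = 1%E /\ P [set w | cube aT sT (Z T w)] = 1%E.
Proof.
case: Z_bernstein => mZ _ _ _ _ marginal.
have T0 : 0 <= (0 : R) <= T by rewrite lexx ltW.
have TT : 0 <= T <= T by rewrite lexx ltW.
split.
- apply: (probability1_density_null (mZ _ T0) (measurable_cube a0 s0) _
    (marginal _ _ T0 (measurableC (measurable_cube a0 s0)))) => x Cx.
  (* At time 0 the definition selects the datum itself, so the left factor is [N * 0], and the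
     product is 0 whatever the real value of the backward solution. *)
  by rewrite /forward_solution eqxx tent_outside_cube// mulr0 mul0r.
- apply: (probability1_density_null (mZ _ TT) (measurable_cube aT sT) _
    (marginal _ _ TT (measurableC (measurable_cube aT sT)))) => x Cx.
  (* Symmetrically, at time [T] the vanishing datum is the right factor. *)
  by rewrite /backward_solution eqxx tent_outside_cube// !mulr0.
Qed.
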